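(* Let $X, Y$ be non-zero ordered normed spaces with the following properties: (1) The cone $X_+$ is total, there exists an equivalent norm on $X$ that is additive on $X_+$, and every extremal vector of $X_+$ is also extremal in the bidual cone $X''_+$ (where $X$ is identified with its canonical image in $X''$). Moreover, the convex hull of the extremal vectors in $X_+$ is dense in $X_+$. (2) The cone $Y_+$ has non-empty interior. Then two operators $T_1, T_2 \in \mathcal{C}(X,Y)$ are disjoint (in the pre-Riesz space $\mathcal{C}(X,Y)$) if and only if, for all extremal vectors $x \in X_+$ and $y' \in Y'_+$, one has $\langle y', T_1 x\rangle = 0$ or $\langle y', T_2 x\rangle = 0$.
   Context: All vector spaces are real. A wedge in a real vector space $V$ is a non-empty subset $V_+$ with $\alpha V_+ + \beta V_+ \subseteq V_+$ for all real $\alpha,\beta \ge 0$; it is a cone if in addition $V_+ \cap (-V_+) = \{0\}$. One writes $x \le y$ if $y - x \in V_+$, and $[v_1,v_2] = \{x \in V : v_1 \le x \le v_2\}$. A vector $v \in V_+$ is called extremal in $V_+$ (an extremal vector of $V_+$) if all elements of $[0,v]$ are scalar multiples of $v$. An ordered normed space is a normed space $X$ (not necessarily complete) endowed with a norm closed cone $X_+$. The cone $X_+$ is total if its linear span is norm dense in $X$. A norm on $X$ is additive on $X_+$ if $\|x_1+x_2\| = \|x_1\|+\|x_2\|$ for all $x_1,x_2\in X_+$. The norm dual $X'$ is endowed with the dual wedge $X'_+ = \{x' \in X' : \langle x', x\rangle \ge 0 \text{ for all } x \in X_+\}$; the bidual $X''$ is endowed with $X''_+ = \{x'' \in X'' :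 \langle x'', x'\rangle \ge 0 \text{ for all } x' \in X'_+\}$. $\mathcal{L}(X,Y)$ is the space of bounded linear operators from $X$ to $Y$ with the operator norm, and $\mathcal{L}(X,Y)_+ = \{T \in \mathcal{L}(X,Y): T[X_+] \subseteq Y_+\}$. $\mathcal{C}(X,Y)$ is the operator norm closure in $\mathcal{L}(X,Y)$ of the subspace of bounded finite rank operators, ordered by $\mathcal{C}(X,Y)_+ = \mathcal{C}(X,Y) \cap \mathcal{L}(X,Y)_+$. A vector lattice cover of an ordered vector space $V$ is a vector lattice $W$ with a bipositive linear map $\Phi : V\to W$ (i.e. $v\ge 0 \iff \Phi(v)\ge 0$) such that each $w\in W$ is the infimum of $\{u\in\Phi[V] : u\ge w\}$; $V$ is a pre-Riesz space if it has a vector lattice cover (every ordered normed space with generating cone is one). Two elements $v_1, v_2$ of a pre-Riesz space $V$ are disjoint if the sets $\{v_1+v_2, -v_1-v_2\}$ and $\{v_1-v_2, v_2-v_1\}$ have the same upper bounds in $V$ (for $v_1,v_2 \ge 0$ this means that the infimum of $v_1,v_2$ in $V$ exists and equals $0$). *)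

(* Defs.v *)
From HB Require Import structures.
From mathcomp Require Import all_boot all_order all_algebra.
From mathcomp Require Import all_classical all_reals all_analysis.

Set Implicit Arguments.
Unset Strict Implicit.
Unset Printing Implicit Defensive.

Import Order.TTheory GRing.Theory Num.Theory.
Import numFieldNormedType.Exports.

Local Open Scope classical_set_scope.
Local Open Scope ring_scope.

Section ordered_vector_spaces.
Context {R : realType} {V : lmodType R}.
Implicit Types (P A : set V) (u v w x : V).

(* An order on V is given by its set P of nonnegative elements, not by a
   porderType instance: the same space occurs with a mere wedge as well. *)
Definition wedge P :=
  P !=set0 /\
  forall (a b : R) u v, 0 <= a -> 0 <= b -> P u -> P v -> P (a *: u + b *: v).

Definition cone P := wedge P /\ P `&` [set - v | v in P] = [set 0].

Definition cone_le P u v := P (v - u).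

Definition cone_itv P u v := [set x | cone_le P u x /\ cone_le P x v].

(* 0 is extremal. *)
Definition extremal P v :=
  P v /\ forall x, cone_itv P 0 v x -> exists a : R, x = a *: v.

Definition upper_bounds P A := [set u | forall v, A v -> cone_le P v u].

(* Disjointness in a pre-Riesz space (V, P); the pre-Riesz property only
   guarantees that the notion is well behaved and is not used to define it. *)
Definition disjoint_elts P u v :=
  upper_bounds P [set u + v; - u - v] = upper_bounds P [set u - v; v - u].

Definition linear_span A := [set x | exists n (c : 'I_n -> R) (e : 'I_n -> V),
  (forall i, A (e i)) /\ x = \sum_i c i *: e i].

Definition convex_hull A := [set x | exists n (c : 'I_n -> R) (e : 'I_n -> V),
  [/\ forall i, A (e i), forall i, 0 <= c i, \sum_i c i = 1
    & x = \sum_i c i *: e i]].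

End ordered_vector_spaces.

Section ordered_normed_spaces.
Context {R : realType} {X : normedModType R}.
Implicit Types (P : set X) (N : X -> R).

Definition ordered_normed_space P := cone P /\ closed P.

Definition total_cone P := dense (linear_span P).

Definition is_norm N :=
  [/\ forall x, N x = 0 -> x = 0,
      forall (a : R) x, N (a *: x) = `|a| * N x
    & forall x y, N (x + y) <= N x + N y].

Definition equivalent_norm N := is_norm N /\
  exists a b : R, [/\ 0 < a, 0 < b & forall x, a * `|x| <= N x <= b * `|x|].

Definition additive_on P N := forall x y, P x -> P y -> N (x + y) = N x + N y.

End ordered_normed_spaces.

Section bounded_operators.
Context {R : realType} (X Y : normedModType R).

Definition bounded_linear (f : X -> Y) :=
  linear f /\ exists M : R, forall x, `|f x| <= M * `|x|.

Definition bounded_linear_pred : {pred X -> Y} := mem [set f | bounded_linear f].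

Lemma bounded_linearP f : reflect (bounded_linear f) (f \in bounded_linear_pred).
Proof. by apply: (iffP idP) => [/set_mem|/mem_set]. Qed.

Lemma bounded_linear_submod : subsemimod_closed bounded_linear_pred.
Proof.
split; first split.
- apply/bounded_linearP; split; first by move=> a x y; rewrite /= scaler0 addr0.
  by exists 0 => x /=; rewrite normr0 mul0r.
- move=> f g /bounded_linearP[lf [M fM]] /bounded_linearP[lg [N gN]].
  apply/bounded_linearP; split.
    by move=> a x y; rewrite !fctE lf lg scalerDr addrACA.
  exists (M + N) => x; rewrite mulrDl.
  exact: le_trans (ler_normD _ _) (lerD (fM x) (gN x)).
move=> k f /bounded_linearP[lf [M fM]]; apply/bounded_linearP; split.
  by move=> a x y; rewrite !fctE lf scalerDr !scalerA mulrC.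
exists (`|k| * M) => x; rewrite fctE normrZ -mulrA.
exact: ler_wpM2l (fM x).
Qed.

Record boundedOp := BoundedOp {
  boundedOp_fun :> X -> Y;
  _ : boundedOp_fun \in bounded_linear_pred }.

HB.instance Definition _ := [isSub for boundedOp_fun].
HB.instance Definition _ := [Choice of boundedOp by <:].
HB.instance Definition _ :=
  GRing.SubChoice_isSubLmodule.Build R (X -> Y) bounded_linear_pred boundedOp
    bounded_linear_submod.

Lemma boundedOp_linear (T : boundedOp) : linear T.
Proof. by case: T => f /= /bounded_linearP[]. Qed.

HB.instance Definition _ (T : boundedOp) :=
  GRing.isLinear.Build R X Y *:%R T (@boundedOp_linear T).

Definition op_norm (T : boundedOp) : R := sup [set `|T x| | x in [set x | `|x| <= 1]].

Lemma op_norm_has_sup (T : boundedOp) :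
  has_sup [set `|T x| | x in [set x | `|x| <= 1]].
Proof.
split; first by exists `|T 0|; exists 0 => //=; rewrite normr0 ler01.
case: T => f /= /bounded_linearP[_ [M fM]]; exists `|M| => _ [x /= x1 <-].
apply: (le_trans (fM x)); apply: (le_trans (ler_norm _)).
by rewrite normrM normr_id ler_piMr.
Qed.

Lemma op_norm_ub (T : boundedOp) x : `|x| <= 1 -> `|T x| <= op_norm T.
Proof. by move=> x1; apply: ub_le_sup; [case: (op_norm_has_sup T)|exists x]. Qed.

Lemma op_norm_le (T : boundedOp) (M : R) :
  (forall x, `|x| <= 1 -> `|T x| <= M) -> op_norm T <= M.
Proof.
move=> TM; apply: ge_sup; first by case: (op_norm_has_sup T).
by move=> _ [x /= /TM ? <-].
Qed.

Lemma op_norm_ge0 (T : boundedOp) : 0 <= op_norm T.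
Proof. by apply: le_trans (op_norm_ub T (x := 0) _); rewrite ?normr0. Qed.

Lemma op_normP (T : boundedOp) x : `|T x| <= op_norm T * `|x|.
Proof.
have [->|x0] := eqVneq x 0; first by rewrite linear0 !normr0 mulr0.
have nx : 0 < `|x| by rewrite normr_gt0.
have := @op_norm_ub T (`|x|^-1 *: x).
rewrite linearZ !normrZ normfV normr_id mulVf ?gt_eqF// => /(_ (lexx _)).
by rewrite ler_pdivrMl// mulrC.
Qed.

Lemma op_normD (S T : boundedOp) : op_norm (S + T) <= op_norm S + op_norm T.
Proof.
apply: op_norm_le => x x1; apply: (le_trans (ler_normD (S x) (T x))).
by apply: lerD; exact: op_norm_ub.
Qed.

Lemma op_normZ_le (a : R) (T : boundedOp) : op_norm (a *: T) <= `|a| * op_norm T.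
Proof.
apply: op_norm_le => x x1; rewrite (normrZ a (T x)).
by rewrite ler_wpM2l// op_norm_ub.
Qed.

Lemma op_normZ (a : R) (T : boundedOp) : op_norm (a *: T) = `|a| * op_norm T.
Proof.
apply/eqP; rewrite eq_le op_normZ_le /=; have [->|a0] := eqVneq a 0.
  by rewrite normr0 mul0r op_norm_ge0.
rewrite -ler_pdivlMl ?normr_gt0//.
have := op_normZ_le a^-1 (a *: T).
by rewrite scalerA mulVf// scale1r normfV.
Qed.

Lemma op_norm0_eq0 (T : boundedOp) : op_norm T = 0 -> T = 0.
Proof.
move=> T0; apply/val_inj/funext => x /=.
by apply/eqP; rewrite -normr_le0 (le_trans (op_normP T x))// T0 mul0r.
Qed.

HB.instance Definition _ :=
  Lmodule_isNormed.Build R boundedOp op_normD op_normZ op_norm0_eq0.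

Definition positive_ops (P : set X) (Q : set Y) : set boundedOp :=
  [set T | forall x, P x -> Q (T x)].

Definition finite_rank : set boundedOp :=
  [set T | exists2 A : set Y, finite_set A & range T `<=` linear_span A].

End bounded_operators.

Arguments bounded_linear_pred {R X Y}.
Arguments finite_rank {R X Y}.

Notation dual X := (boundedOp X (GRing.regular _)).

Section dual.
Context {R : realType} {X : normedModType R}.

Definition dual_wedge (P : set X) : set (dual X) :=
  [set f | forall x, P x -> 0 <= f x :> R].

(* The canonical embedding of X in X'' sends x to evaluation at x. *)
Definition eval_at (x : X) (f : dual X) : R^o := f x.

Lemma eval_at_bounded x : eval_at x \in bounded_linear_pred.
Proof.
apply/bounded_linearP; split => //.
by exists `|x| => f; rewrite mulrC; exact: op_normP.
Qed.

Definition bidual_embedding (x : X) : dual (dual X) :=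
  BoundedOp (eval_at_bounded x).

End dual.

Section approximable_operators.
Context {R : realType} (X Y : normedModType R).

Definition approximable_pred : {pred boundedOp X Y} := mem (closure finite_rank).

Lemma linear_span_setU (A B : set Y) (a b : R) x y : linear_span A x ->
  linear_span B y -> linear_span (A `|` B) (a *: x + b *: y).
Proof.
move=> [n [c [e [Ae ->]]]] [m [d [g [Bg ->]]]]; exists (n + m)%N.
exists (fun i => match fintype.split i with inl i => a * c i | inr i => b * d i end).
exists (fun i => match fintype.split i with inl i => e i | inr i => g i end).
split; first by move=> i; case: fintype.split => j; [left|right].
rewrite big_split_ord /= !scaler_sumr; congr (_ + _); apply: eq_bigr => i _.
  by rewrite (unsplitK (inl i)) scalerA.
by rewrite (unsplitK (inr i)) scalerA.
Qed.

Lemma finite_rankD (a b : R) (S T : boundedOp X Y) :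
  finite_rank S -> finite_rank T -> finite_rank (a *: S + b *: T).
Proof.
move=> [A fA SA] [B fB TB]; exists (A `|` B); first by rewrite finite_setU.
by move=> _ [x _ <-]; apply: linear_span_setU; [apply: SA|apply: TB]; exists x.
Qed.

Lemma approximableD (a b : R) (S T : boundedOp X Y) :
  closure finite_rank S -> closure finite_rank T ->
  closure finite_rank (a *: S + b *: T).
Proof.
move=> cS cT U nU.
have cvg : (fun z : boundedOp X Y * boundedOp X Y => a *: z.1 + b *: z.2)
    @ (S, T) --> a *: S + b *: T.
  by apply: cvgD; apply: cvgZr; [exact: cvg_fst|exact: cvg_snd].
have [[U1 U2] /= [nU1 nU2] U12] := cvg U nU.
have [S' [fS' US']] := cS _ nU1; have [T' [fT' UT']] := cT _ nU2.
exists (a *: S' + b *: T'); split; first exact: finite_rankD.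
by apply: (U12 (S', T')).
Qed.

Lemma approximable_submod : subsemimod_closed approximable_pred.
Proof.
have c0 : closure (@finite_rank _ X Y) 0.
  apply: subset_closure; exists set0 => // _ [x _ <-].
  by exists 0%N, (fun=> 0), (fun=> 0); split=> [[]//|]; rewrite big_ord0.
split; first split.
- exact: mem_set.
- move=> S T /set_mem cS /set_mem cT; apply: mem_set.
  by have := approximableD (a := 1) (b := 1) cS cT; rewrite !scale1r.
move=> a T /set_mem cT; apply: mem_set.
by have := approximableD (a := a) (b := 0) cT c0; rewrite scale0r addr0.
Qed.

(* Only the linear structure of C(X, Y) is needed: its norm enters through the
   closure taken in boundedOp X Y. *)
Record approximableOp := ApproximableOp {
  approximableOp_val :> boundedOp X Y;
  _ : approximableOp_val \in approximable_pred }.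

HB.instance Definition _ := [isSub for approximableOp_val].
HB.instance Definition _ := [Choice of approximableOp by <:].
HB.instance Definition _ :=
  GRing.SubChoice_isSubLmodule.Build R (boundedOp X Y) approximable_pred
    approximableOp approximable_submod.

Definition positive_approximable (P : set X) (Q : set Y) : set approximableOp :=
  [set T | positive_ops P Q T].

End approximable_operators.

(* Main.v *)
From HB Require Import structures.
Require Import Defs.
From mathcomp Require Import all_boot all_order all_algebra.
From mathcomp Require Import all_classical all_reals all_analysis.
From mathcomp Require Import ring lra.
Import Order.TTheory GRing.Theory Num.Theory.
Import numFieldNormedType.Exports.
Local Open Scope classical_set_scope.
Local Open Scope ring_scope.

(** Both implications go through the functionals [evaluation x y'], which send
    T to y'(T x), for extremal x in X_+ and extremal y' in Y'_+. Two facts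
    about them are needed.

    They determine the order of C(X, Y) ([positive_approximable_extremal]). As
    the extremal vectors have a dense convex hull in X_+ and Y_+ is closed, T
    is positive as soon as it sends extremal vectors into Y_+. As Y_+ has an
    interior point, membership in Y_+ is tested by the extremal elements of
    Y'_+ ([extremal_separation], a form of the Krein-Milman theorem for the
    base of Y'_+). Hence S is an upper bound of A and -A if and only if
    |y'(A x)| <= y'(S x) for all such x and y'. If y'(T1 x) = 0 or
    y'(T2 x) = 0, the numbers y'(T1 x) + y'(T2 x) and y'(T1 x) - y'(T2 x) have
    the same absolute value, so that the upper bounds defining disjointness
    coincide.

    They are extremal among the positive functionals on C(X, Y)
    ([evaluation_extremal]). Let 0 <= h <= evaluation x y'. For fixed y >= 0,
    the functional f |-> h(f ⊗ y) lies below a multiple of x in X''_+, hence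
    is itself a multiple of x, because x stays extremal in the bidual cone;
    for fixed f >= 0, the functional y |-> h(f ⊗ y) is likewise a multiple of
    y'. So h is a multiple of evaluation x y' on rank one operators, hence on
    finite rank operators, hence on C(X, Y) by continuity. Continuity and the
    passage to arbitrary f rest on an order unit: the additive norm gives a
    functional e with e(x) >= a |x| on X_+ ([additive_norm_functional]), and
    e ⊗ u is an order unit of C(X, Y) when u is interior to Y_+
    ([approximable_order_unit]).

    For an extremal positive functional phi on an ordered space with
    generating wedge, the infimum of phi over the upper bounds of A and -A is
    |phi A| ([extremal_functional_abs]). So disjointness of T1 and T2 gives
    |phi T1 + phi T2| = |phi T1 - phi T2|, that is, phi T1 = 0 or phi T2 = 0
    ([extremal_functional_disjoint]).

    The functionals themselves come from one application of Zorn's lemma to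
    sublinear functionals ([linear_minorant]), which yields both the
    Hahn-Banach theorem and the existence of extremal functionals. *)

Set Implicit Arguments.
Unset Strict Implicit.
Unset Printing Implicit Defensive.

(** * Sublinear functionals and their linear minorants *)

Section sublinear_functionals.
Context {R : realType} {V : lmodType R}.
Implicit Types (p q : V -> R) (x y z : V) (C : set (V -> R)).

Definition sublinear q := forall (a b : R) x y, 0 <= a -> 0 <= b ->
  q (a *: x + b *: y) <= a * q x + b * q y.

Lemma sublinearD q x y : sublinear q -> q (x + y) <= q x + q y.
Proof.
by move=> /(_ 1 1 x y ler01 ler01); rewrite !scale1r !mul1r.
Qed.

Lemma sublinear0 q : sublinear q -> q 0 = 0.
Proof.
move=> sq; have := sublinearD 0 0 sq; rewrite addr0 => ?.
have := sq 0 0 0 0 (lexx _) (lexx _); rewrite !scale0r addr0 !mul0r addr0.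
by move=> ?; apply/eqP; rewrite eq_le; apply/andP; split; lra.
Qed.

Lemma sublinearZ q a x : sublinear q -> 0 <= a -> q (a *: x) = a * q x.
Proof.
move=> sq a0; have le b y : 0 <= b -> q (b *: y) <= b * q y.
  move=> b0; have := sq b 0 y 0 b0 (lexx _).
  by rewrite scale0r addr0 mul0r addr0.
apply/eqP; rewrite eq_le le//=; have [->|an0] := eqVneq a 0.
  by rewrite scale0r mul0r sublinear0.
have := le a^-1 (a *: x); rewrite invr_ge0 scalerA mulVf// scale1r => /(_ a0).
by rewrite ler_pdivlMl// lt_neqAle eq_sym an0.
Qed.

Lemma sublinearN q x : sublinear q -> - q (- x) <= q x.
Proof.
move=> sq; have := sublinearD x (- x) sq; rewrite subrr sublinear0//; lra.
Qed.

Lemma le_mul_inf (A : set R) (c m : R) : A !=set0 -> 0 <= c ->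
  (forall r, A r -> m <= c * r) -> m <= c * inf A.
Proof.
move=> [r0 Ar0]; rewrite le_eqVlt => /predU1P[<- |c0] mA.
  by have := mA _ Ar0; rewrite !mul0r.
rewrite mulrC -ler_pdivrMr//; apply: lb_le_inf; first by exists r0.
by move=> r /mA; rewrite ler_pdivrMr// mulrC.
Qed.

(** Gauges, tilts and infima of chains are all of this shape. The hypothesis
    says that the pairs (x, s) with s above some element of [A x] form a convex
    cone. *)
Lemma sublinear_inf (A : V -> set R) :
  (forall x, has_inf (A x)) ->
  (forall a b x y r s, 0 <= a -> 0 <= b -> A x r -> A y s ->
    exists2 t, A (a *: x + b *: y) t & t <= a * r + b * s) ->
  sublinear (fun x => inf (A x)).
Proof.
move=> infA convA a b x y a0 b0; rewrite -lerBlDr.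
apply: le_mul_inf => // [|r Axr]; first by case: (infA x).
rewrite lerBlDr -lerBlDl; apply: le_mul_inf => // [|s Ays].
  by case: (infA y).
have [t At tle] := convA a b x y r s a0 b0 Axr Ays.
by rewrite lerBlDl; apply: le_trans tle; exact: ge_inf (proj2 (infA _)) _ At.
Qed.

(** The largest sublinear functional below [q] whose value at [- z] is
    [- q z]; its linear minorants are those of [q] that agree with [q] at [z].
    *)
Definition tilt q z x :=
  inf [set q (x + t *: z) - t * q z | t in [set t | 0 <= t]].

Lemma tilt_has_inf q z x : sublinear q ->
  has_inf [set q (x + t *: z) - t * q z | t in [set t | 0 <= t]].
Proof.
move=> sq; split; first by exists (q (x + 0 *: z) - 0 * q z), 0 => /=.
exists (- q (- x)) => _ [t /= t0 <-].
have := sublinearD (x + t *: z) (- x) sq.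
by rewrite addrAC subrr add0r sublinearZ// => ?; lra.
Qed.

Lemma tilt_le q z x t : sublinear q -> 0 <= t ->
  tilt q z x <= q (x + t *: z) - t * q z.
Proof.
by move=> sq t0; apply: ge_inf; [case: (tilt_has_inf z x sq)|exists t].
Qed.

Lemma tilt_le_self q z x : sublinear q -> tilt q z x <= q x.
Proof.
move=> sq; have := tilt_le z x sq (lexx 0).
by rewrite scale0r addr0 mul0r subr0.
Qed.

Lemma tilt_opp q z : sublinear q -> tilt q z (- z) <= - q z.
Proof.
move=> sq; have := tilt_le z (- z) sq ler01.
by rewrite scale1r addNr sublinear0// mul1r sub0r.
Qed.

Lemma tilt_sublinear q z : sublinear q -> sublinear (tilt q z).
Proof.
move=> sq; apply: sublinear_inf => [x|]; first exact: tilt_has_inf.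
move=> a b x y _ _ a0 b0 [s /= s0 <-] [t /= t0 <-].
exists (q (a *: x + b *: y + (a * s + b * t) *: z) - (a * s + b * t) * q z).
  by exists (a * s + b * t) => //=; rewrite addr_ge0// mulr_ge0.
have -> : a *: x + b *: y + (a * s + b * t) *: z
        = a *: (x + s *: z) + b *: (y + t *: z).
  by rewrite !scalerDr !scalerA scalerDl addrACA.
have := sq a b (x + s *: z) (y + t *: z) a0 b0; lra.
Qed.

(** A sublinear functional is linear once it cannot be lowered: if [q] is
    minimal then [tilt q z = q], so that [q (- z) <= - q z]. The set [G] is any
    property that survives tilting and infima, which lets the minorant inherit
    more than linearity. *)
Lemma linear_minorant (G : set (V -> R)) p :
  sublinear p -> G p ->
  (forall q z, sublinear q -> G q -> G (tilt q z)) ->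
  (forall C, C !=set0 -> C `<=` sublinear `&` G ->
    (forall x, has_lbound [set q x | q in C]) ->
    G (fun x => inf [set q x | q in C])) ->
  exists f : {scalar V}, G f /\ forall x, f x <= p x.
Proof.
move=> sp Gp Gtilt Ginf.
pose T := {q : V -> R | [/\ sublinear q, G q & forall x, q x <= p x]}.
pose ge : rel T := fun a b => `[< forall x, sval b x <= sval a x >].
have p_T : [/\ sublinear p, G p & forall x, p x <= p x] by [].
have [||C totC|[q [sq Gq qp]] qmin] := @ZL_preorder T (exist _ p p_T) ge.
- by move=> a; apply/asboolP.
- move=> b a c /asboolP ab /asboolP bc; apply/asboolP => x.
  exact: le_trans (bc x) (ab x).
- have [[a0 Ca0]|C0] := pselect (C !=set0); last first.
    by exists (exist _ p p_T) => a Ca; exfalso; apply: C0; exists a.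
  pose D := [set sval a | a in C].
  have D0 : D !=set0 by exists (sval a0), a0.
  have DsG : D `<=` sublinear `&` G by move=> _ [a _ <-]; case: (svalP a).
  have lbD x : lbound [set q x | q in D] (- p (- x)).
    move=> _ [_ [a Ca <-] <-]; have [sa _ ap] := svalP a.
    by apply: le_trans (sublinearN _ sa); rewrite lerN2.
  pose m x := inf [set q x | q in D].
  have mle a x : C a -> m x <= sval a x.
    move=> Ca; apply: ge_inf; first by exists (- p (- x)).
    by exists (sval a) => //; exists a.
  suff m_T : [/\ sublinear m, G m & forall x, m x <= p x].
    by exists (exist _ m m_T) => a Ca; apply/asboolP => x; exact: mle.
  split; last first.
  + by move=> x; apply: le_trans (mle _ x Ca0) _; case: (svalP a0).
  + by apply: Ginf => // x; exists (- p (- x)).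
  apply: sublinear_inf => [x|].
    by split; [case: D0 => q Dq; exists (q x), q|exists (- p (- x))].
  move=> a b x y _ _ a_ge0 b_ge0 [_ [c Cc <-] <-] [_ [d Cd <-] <-].
  (* D is a chain, so the smaller of the two functionals serves for both *)
  wlog cd : a b x y c d a_ge0 b_ge0 Cc Cd / forall x, sval c x <= sval d x.
    move=> wl; have [/asboolP dc|/asboolP cd] := totC c d Cc Cd; last first.
      exact: wl cd.
    have [t Dt tle] := wl b a y x d c b_ge0 a_ge0 Cd Cc dc.
    by exists t; rewrite addrC.
  exists (sval c (a *: x + b *: y)).
    by exists (sval c) => //; exists c.
  have [sc _ _] := svalP c; apply: le_trans (sc _ _ _ _ a_ge0 b_ge0) _.
  by rewrite lerD2l; exact: ler_wpM2l.
have qN z : q (- z) = - q z.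
  apply/eqP; rewrite eq_le; apply/andP; split; last first.
    by have := sublinearN (- z) sq; rewrite opprK.
  have t_T : [/\ sublinear (tilt q z), G (tilt q z)
      & forall x, tilt q z x <= p x].
    split; [exact: tilt_sublinear|exact: Gtilt|move=> x].
    exact: le_trans (tilt_le_self z x sq) (qp x).
  have /asboolP qt : ge (exist _ _ t_T) (exist _ q (And3 sq Gq qp)).
    by apply: qmin; apply/asboolP => x /=; exact: tilt_le_self.
  exact: le_trans (qt (- z)) (tilt_opp z sq).
have qD x y : q (x + y) = q x + q y.
  apply/eqP; rewrite eq_le sublinearD//=.
  by have := sublinearD (- x) (- y) sq; rewrite -opprD !qN => ?; lra.
have lin_q : scalar q.
  move=> a x y; rewrite qD; congr (_ + _).
  have [a0|a0] := leP 0 a; first exact: sublinearZ.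
  by rewrite -[a]opprK scaleNr qN sublinearZ ?mulNr// oppr_ge0 ltW.
pose fL := GRing.isLinear.Build R V R *%R q lin_q.
by exists (HB.pack_for {scalar V} q fL).
Qed.

(** A minorant of [tilt p z] is a minorant of [p] that attains [p z]. *)
Lemma hahn_banach p z : sublinear p ->
  exists f : {scalar V}, (forall x, f x <= p x) /\ f z = p z.
Proof.
move=> sp; have [|||f [_ fle]] := @linear_minorant setT (tilt p z) _ I => //.
  exact: tilt_sublinear.
exists f; split=> [x|]; first exact: le_trans (fle x) (tilt_le_self z x sp).
apply/eqP; rewrite eq_le (le_trans (fle z) (tilt_le_self z z sp))/=.
have := le_trans (fle (- z)) (tilt_opp z sp).
by rewrite raddfN lerN2.
Qed.

End sublinear_functionals.

(** * Wedges *)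
Section wedges.
Context {R : realType} {V : lmodType R} (P : set V).
Hypothesis wP : wedge P.

Lemma wedgeD u v : P u -> P v -> P (u + v).
Proof.
by move=> Pu Pv; have := wP.2 1 1 u v ler01 ler01 Pu Pv; rewrite !scale1r.
Qed.

Lemma wedge0 : P 0.
Proof.
have [[u Pu] /(_ 0 0 u u (lexx _) (lexx _) Pu Pu)] := wP.
by rewrite !scale0r addr0.
Qed.

Lemma wedgeZ a u : 0 <= a -> P u -> P (a *: u).
Proof.
move=> a0 Pu; have := wP.2 a 0 u 0 a0 (lexx _) Pu wedge0.
by rewrite scaler0 addr0.
Qed.

Lemma wedge_scalable a u : 0 < a -> P (a *: u) -> P u.
Proof.
move=> a0 Pau; rewrite -[u]scale1r -(mulVf (lt0r_neq0 a0)) -scalerA.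
by apply: wedgeZ => //; rewrite invr_ge0 ltW.
Qed.

Lemma extremalZ a v : 0 < a -> extremal P v -> extremal P (a *: v).
Proof.
move=> a0 [Pv ext_v]; split; first exact: wedgeZ (ltW a0) Pv.
move=> x; rewrite /cone_itv /cone_le /= subr0 => -[Px Pvx].
have a_unit := mulVf (lt0r_neq0 a0).
have [|b xE] := ext_v (a^-1 *: x).
  split; rewrite /cone_le ?subr0.
    by apply: wedgeZ => //; rewrite invr_ge0 ltW.
  rewrite -[v]scale1r -a_unit -scalerA -scalerBr.
  by apply: wedgeZ => //; rewrite invr_ge0 ltW.
exists b; rewrite scalerA mulrC -scalerA -xE scalerA divff ?scale1r//.
exact: lt0r_neq0.
Qed.

End wedges.

Definition positive_functional {R : realType} {V : lmodType R} (P : set V)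
  (f : {scalar V}) := forall v, P v -> 0 <= f v.

(** * Extremal functionals of a cone with interior *)

Section facial_functionals.
Context {R : realType} {V : lmodType R} (P : set V) (u : V).
Hypothesis Pu : P u.

(** For [u] an order unit and [c := f u + g u > 0], this says that the
    functionals of value 1 at [u] below [q] form a face of the base of the dual
    wedge: the convex combination [(f + g) / c] lies below [q] only if
    [f / f u] does. The homogeneous form avoids the divisions. *)
Definition facial (q : V -> R) := forall f g : {scalar V},
  positive_functional P f -> positive_functional P g ->
  (forall v, f v + g v <= (f u + g u) * q v) -> forall v, f v <= f u * q v.

(** The linear minorants of [tilt q z] maximize the value at [z] among those of
    [q], and the maximizers of a linear form on a face are again a face. *)
Lemma facial_tilt q z : sublinear q -> facial q -> facial (tilt q z).
Proof.
move=> sq fq f g f0 g0 fgq v.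
have fu0 := f0 _ Pu; have gu0 := g0 _ Pu.
have fgq' w : f w + g w <= (f u + g u) * q w.
  apply: le_trans (fgq w) _; apply: ler_wpM2l; first exact: addr_ge0.
  exact: tilt_le_self.
have fle := fq f g f0 g0 fgq'.
have gle : forall w, g w <= g u * q w.
  by apply: (fq g f g0 f0) => w; rewrite [g w + _]addrC [g u + _]addrC.
have fz : f z = f u * q z.
  have := le_trans (fgq (- z)) (ler_wpM2l (addr_ge0 fu0 gu0) (tilt_opp z sq)).
  by rewrite !raddfN /= => ?; have := fle z; have := gle z; lra.
apply: le_mul_inf => // [|_ [t /= t0 <-]].
  by have [] := tilt_has_inf z v sq.
by have := fle (v + t *: z); rewrite raddfD /= scalarZ fz; lra.
Qed.

Lemma facial_inf (C : set (V -> R)) : C !=set0 -> C `<=` facial ->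
  (forall v, has_lbound [set q v | q in C]) ->
  facial (fun v => inf [set q v | q in C]).
Proof.
move=> [q0 Cq0] Cf lbC f g f0 g0 fgq v; apply: le_mul_inf.
- by exists (q0 v), q0.
- exact: f0.
move=> _ [q Cq <-]; apply: (Cf _ Cq f g) => // w.
apply: le_trans (fgq w) _; apply: ler_wpM2l.
  by rewrite addr_ge0 ?f0 ?g0.
by apply: ge_inf => //; exists q.
Qed.

End facial_functionals.

Section dual_functionals.
Context {R : realType} {X : normedModType R}.

(** Elements of the dual are linear for the scaling of the regular module; this
    copy is linear for the multiplication of [R]. *)
Definition scalar_of (f : dual X) : X -> R := f.

HB.instance Definition _ (f : dual X) :=
  GRing.isLinear.Build R X R *%R (scalar_of f) (@boundedOp_linear _ _ _ f).

Lemma bounded_scalar (f : X -> R) (M : R) : scalar f ->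
  (forall x, `|f x| <= M * `|x|) -> exists g : dual X, forall x, g x = f x.
Proof.
move=> lf fM; suff fb : (f : X -> R^o) \in bounded_linear_pred.
  by exists (BoundedOp fb).
by apply/bounded_linearP; split; [|exists M].
Qed.

Lemma dual_normP (f : dual X) x : `|f x : R| <= `|f| * `|x|.
Proof. exact: op_normP. Qed.

Lemma dual_wedge_wedge (P : set X) : wedge (dual_wedge P).
Proof.
split; first by exists 0 => x Px; exact: lexx.
move=> a b f g a0 b0 Pf Pg x Px.
by apply: addr_ge0; apply: mulr_ge0 => //; [exact: Pf|exact: Pg].
Qed.

End dual_functionals.

Section order_units.
Context {R : realType} {Y : normedModType R} (P : set Y).
Hypotheses (wP : wedge P) (cP : closed P).

Lemma interior_order_unit u : interior P u ->
  exists2 r : R, 0 < r & forall y, P (`|y| *: u + r *: y).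
Proof.
move=> /nbhs_ballP[r /= r0 rP]; exists (r / 2); first lra.
move=> y; have [->|y0] := eqVneq y 0.
  by rewrite normr0 scale0r scaler0 addr0; exact: wedge0.
have ny : 0 < `|y| by rewrite normr_gt0.
apply: (@wedge_scalable _ _ P wP `|y|^-1); first by rewrite invr_gt0.
rewrite scalerDr !scalerA mulVf ?gt_eqF// scale1r; apply: rP.
rewrite -ball_normE /= opprD addNKr normrN normrZ.
rewrite normrM normfV normr_id mulrAC mulVf ?gt_eqF// mul1r gtr0_norm; lra.
Qed.

Lemma closed_wedge_limit u y :
  (forall e : R, 0 < e -> P (e *: u + y)) -> P y.
Proof.
move=> Pe; apply: cP => U Uy.
have : (fun e : R => e *: u + y) @ 0^'+ --> y.
  rewrite -[X in _ --> X]add0r -(scale0r u); apply: cvgD; last exact: cvg_cst.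
  by apply: cvgZl; exact: cvg_at_right_filter.
move=> /(_ U Uy) near_U.
have [e [e0 Ue]] : exists e : R, 0 < e /\ U (e *: u + y).
  near (0 : R)^'+ => e; exists e; split; near: e => //.
  exact: nbhs_right_gt.
by exists (e *: u + y); split => //; exact: Pe.
Unshelve. all: by end_near. Qed.

End order_units.

Section extremal_functionals.
Context {R : realType} {Y : normedModType R} (P : set Y).
Hypotheses (wP : wedge P) (cP : closed P).

Definition gauge (u y : Y) := inf [set t : R | P (t *: u - y)].

(** The gauge of [u] tilted towards [y0] is facial, so it has a facial linear
    minorant [f]: a positive functional of value 1 at [u] that is minimal at
    [y0]. A linear [f] whose minorants form a face is an extreme point of the
    base of the dual wedge, that is, an extremal functional. *)
Lemma extremal_separation u y0 : interior P u -> ~ P y0 ->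
  exists2 f : dual Y, extremal (dual_wedge P) f & f y0 < 0 :> R.
Proof.
move=> Pu nPy0; have [r r0 rP] := interior_order_unit wP Pu.
have {Pu} Pu : P u by apply: nbhs_singleton.
(* otherwise P is the whole space, and the gauge is not bounded below *)
have nPNu : ~ P (- u).
  move=> PNu; apply: nPy0; apply: (wedge_scalable wP r0).
  rewrite -[_ *: _](addKr (`|y0| *: u)) -scalerN.
  by apply: wedgeD => //; apply: wedgeZ.
have Punit y : P ((`|y| / r) *: u - y).
  apply: (wedge_scalable wP r0).
  rewrite scalerBr scalerA mulrCA divff ?gt_eqF//.
  by rewrite mulr1 -(normrN y) -scalerN.
have ginf y : has_inf [set t : R | P (t *: u - y)].
  split; first by exists (`|y| / r).
  exists (- (`|y| / r)) => t /= Pt; rewrite leNgt; apply/negP => tlt.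
  apply: nPNu; apply: (@wedge_scalable _ _ P wP (- (t + `|y| / r))); first lra.
  rewrite scalerN scaleNr opprK scalerDl.
  have := wedgeD wP Pt (Punit (- y)).
  by rewrite normrN opprK addrACA addNr addr0.
have gle t y : P (t *: u - y) -> gauge u y <= t.
  by apply: ge_inf; case: (ginf y).
have sg : sublinear (gauge u).
  apply: sublinear_inf => // a b x y s t a0 b0 /= Ps Pt.
  exists (a * s + b * t) => //.
  have := wP.2 a b _ _ a0 b0 Ps Pt.
  by rewrite !scalerBr !scalerA addrACA -scalerDl -opprD.
have fg : facial P u (gauge u).
  move=> f g f0 g0 _ y; apply: le_mul_inf; [by case: (ginf y)|exact: f0|].
  move=> t /= /f0; rewrite raddfB /= scalarZ; lra.
have gy0 : 0 < gauge u (- y0).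
  rewrite ltNge; apply/negP => gle0; apply: nPy0.
  apply: (closed_wedge_limit cP (u := u)) => e e0.
  have [t /= Pt te] := inf_adherent e0 (ginf (- y0)).
  have te' : 0 <= e - t by move: gle0; rewrite /gauge; lra.
  have := wedgeD wP (wedgeZ wP te' Pu) Pt.
  by rewrite scalerBl addrA addrNK opprK.
have [||||f [ff fle]] := @linear_minorant _ _ (facial P u)
    (tilt (gauge u) (- y0)).
- exact: tilt_sublinear.
- exact: facial_tilt.
- by move=> q z; exact: facial_tilt.
- by move=> C C0 Cf; apply: facial_inf => // q /Cf[].
have fle_gauge y : f y <= gauge u y.
  exact: le_trans (fle y) (tilt_le_self _ _ sg).
have fy0 : f y0 < 0.
  have := fle (- - y0); rewrite opprK => /le_lt_trans; apply.
  by have := tilt_opp (- y0) sg; rewrite opprK; lra.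
have f_pos : positive_functional P f.
  move=> y Py; have := fle_gauge (- y); rewrite raddfN /= => fy.
  have : gauge u (- y) <= 0 by apply: gle; rewrite scale0r sub0r opprK.
  lra.
have fu : f u = 1.
  have := fle_gauge u; have := fle_gauge (- u); rewrite raddfN /=.
  have : gauge u u <= 1 by apply: gle; rewrite scale1r subrr; exact: wedge0.
  have : gauge u (- u) <= -1.
    by apply: gle; rewrite scaleN1r subrr; exact: wedge0.
  lra.
have [g gE] : exists g : dual Y, forall y, g y = f y.
  apply: (@bounded_scalar _ _ f r^-1 (linearP f)) => y.
  have fle1 z : f z <= r^-1 * `|z|.
    by rewrite mulrC; apply: le_trans (fle_gauge z) (gle _ _ _).
  by rewrite ler_norml; have := fle1 y; have := fle1 (- y);
    rewrite raddfN normrN /=; lra.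
exists g; last by rewrite gE.
split; first by move=> y Py; rewrite gE; exact: f_pos.
move=> h; rewrite /cone_itv /cone_le /= subr0 => -[h0 hg].
have hle y : scalar_of h y <= scalar_of h u * f y.
  apply: (ff (scalar_of h) (scalar_of (g - h))) => // {}y.
  have E z : scalar_of h z + scalar_of (g - h) z = f z.
    by rewrite -gE addrC subrK.
  by rewrite !E fu mul1r.
exists (h u); apply/val_inj/funext => y.
have := hle (- y); have := hle y; rewrite !raddfN /= mulrN lerN2 -gE.
by move=> h1 h2; apply/eqP; rewrite eq_le; apply/andP; split.
Qed.

End extremal_functionals.

(** * Disjointness and extremal positive functionals *)

Section disjointness.
Context {R : realType} {V : lmodType R} (P : set V).
Hypotheses (wP : wedge P) (genP : forall v, exists w, P w /\ P (w - v)).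

Definition extremal_functional (f : {scalar V}) := positive_functional P f /\
  forall g : {scalar V}, positive_functional P g ->
    (forall v, P v -> g v <= f v) -> exists t, forall v, g v = t * f v.

(** The infimum of [f] over the upper bounds of 0 and [v] is sublinear in [v].
    A linear minorant [g] attaining it at [v] satisfies [0 <= g <= f], so that
    [g = t f], where [0 <= t <= 1] unless [f] vanishes; and then [t f(v)] is at
    most the maximum of [f v] and 0. *)
Lemma extremal_functional_inf (f : {scalar V}) v (eps : R) :
  extremal_functional f -> 0 < eps ->
  exists w, [/\ P w, P (w - v) & f w < Num.max (f v) 0 + eps].
Proof.
move=> [f0 fext] eps0.
pose A v := [set f w | w in [set w | P w /\ P (w - v)]].
have infA v' : has_inf (A v').
  split; first by have [w Pw] := genP v'; exists (f w), w.
  by exists 0 => _ [w [Pw _] <-]; exact: f0.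
have sp : sublinear (fun v => inf (A v)).
  apply: sublinear_inf => // a b x y _ _ a0 b0 [s [Ps Psx] <-] [t [Pt Pty] <-].
  exists (f (a *: s + b *: t)); last by rewrite raddfD /= !scalarZ.
  exists (a *: s + b *: t) => //; split; first exact: wP.2.
  by rewrite opprD addrACA -!scalerBr; exact: wP.2.
have ple w x : P w -> P (w - x) -> inf (A x) <= f w.
  by move=> Pw Pwx; apply: ge_inf; [case: (infA x)|exists w].
have [g [gp gv]] := hahn_banach v sp.
have g0 : positive_functional P g.
  move=> w Pw; have := le_trans (gp (- w)) (ple 0 _ (wedge0 wP) _).
  by rewrite sub0r opprK !raddfN raddf0 /= oppr_le0; exact.
have gf w : P w -> g w <= f w.
  move=> Pw; apply: le_trans (gp w) (ple _ _ Pw _).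
  by rewrite subrr; exact: wedge0.
have [t gE] := fext g g0 gf.
suff pv : inf (A v) <= Num.max (f v) 0.
  have [_ [w [Pw Pwv] <-] fw] := inf_adherent eps0 (infA v).
  by exists w; split=> //; apply: lt_le_trans fw _; rewrite lerD2r.
rewrite -gv gE le_max; case: (ltgtP (f v) 0) => fv.
- apply/orP; right; have [w [Pw]] := genP (- v); rewrite opprK => Pwv.
  have := f0 _ Pwv; rewrite raddfD /= => fwv.
  have fw : 0 < f w by lra.
  have : 0 <= t by have := g0 _ Pw; rewrite gE pmulr_lge0.
  by move=> t0; rewrite mulr_ge0_le0// ltW.
- apply/orP; left; have [w [Pw Pwv]] := genP v.
  have := f0 _ Pwv; rewrite raddfB /= => fwv.
  have fw : 0 < f w by lra.
  have : t <= 1 by have := gf _ Pw; rewrite gE ger_pMl.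
  by move=> t1; rewrite ger_pMl.
- by rewrite fv mulr0 lexx.
Qed.

(** The upper bounds of [v] and [- v] are the translates by [- v] of those of
    [2 v] and 0. *)
Lemma extremal_functional_abs (f : {scalar V}) v (eps : R) :
  extremal_functional f -> 0 < eps ->
  exists w, [/\ P (w - v), P (w + v) & f w < `|f v| + eps].
Proof.
move=> fext eps0.
have [w [Pw Pwv fw]] := extremal_functional_inf (v *+ 2) fext eps0.
exists (w - v); split; [by rewrite -addrA -opprD -mulr2n|by rewrite subrK|].
move: fw; rewrite raddfB raddfMn /= mulr2n.
rewrite /Num.max; case: ifP => + fw; first by move=> ?; rewrite ler0_norm; lra.
by move=> /negbT; rewrite -leNgt => ?; rewrite ger0_norm; lra.
Qed.

Lemma extremal_functional_disjoint (f : {scalar V}) v1 v2 :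
  extremal_functional f -> disjoint_elts P v1 v2 -> f v1 = 0 \/ f v2 = 0.
Proof.
move=> fext dis.
have f0 := fext.1.
have le_abs a b : upper_bounds P [set a; - a] = upper_bounds P [set b; - b] ->
    `|f b| <= `|f a|.
  move=> ubE; apply/ler_addgt0Pr => eps eps0.
  have [w [Pwa Pwa' fw]] := extremal_functional_abs a fext eps0.
  have : upper_bounds P [set b; - b] w.
    by rewrite -ubE => _ [->|->]; rewrite /cone_le ?opprK.
  move=> wb; have := f0 _ (wb b (or_introl erefl)).
  have := f0 _ (wb (- b) (or_intror erefl)).
  rewrite !raddfB raddfN /= => ? ?.
  by apply: (@le_trans _ _ (f w)); [rewrite ler_norml; lra|exact: ltW].
have ubE : upper_bounds P [set v1 + v2; - (v1 + v2)] =
           upper_bounds P [set v1 - v2; - (v1 - v2)].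
  by rewrite opprB opprD; exact: dis.
have := conj (le_abs _ _ ubE) (le_abs _ _ (esym ubE)).
rewrite raddfB raddfD /= => -[le1 le2].
have /eqP : `|f v1 + f v2| = `|f v1 - f v2| by apply/eqP; rewrite eq_le le1 le2.
rewrite eqr_norm2 => /orP[] /eqP ?; [right|left]; lra.
Qed.

End disjointness.

(** * The functional of an additive norm *)

Section additive_norms.
Context {R : realType} {X : normedModType R} (P : set X).
Hypothesis wP : wedge P.

(** On [P] the additive norm is itself the restriction of a linear functional.
    The sublinear functional is chosen so that a minorant [f] satisfies
    [f y + N x <= N (y + x)] for [x] in [P]: then [f <= N], and [y = - x] gives
    [N x <= f x]. *)
Lemma additive_norm_functional (N : X -> R) :
  equivalent_norm N -> additive_on P N ->
  exists (e : dual X) (a : R), 0 < a /\ forall x, P x -> a * `|x| <= e x.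
Proof.
move=> [[_ NZ ND] [a [b [a0 b0 Nab]]]] addN.
have NN x : N (- x) = N x by rewrite -scaleN1r NZ normrN1 mul1r.
pose A y := [set N (y + x) - N x | x in P].
have infA y : has_inf (A y).
  split; first by exists (N (y + 0) - N 0), 0 => //; exact: wedge0.
  exists (- N y) => _ [x _ <-].
  by have := ND (y + x) (- y); rewrite addrAC subrr add0r NN; lra.
have sp : sublinear (fun y => inf (A y)).
  apply: sublinear_inf => // c d x y _ _ c0 d0 [s Ps <-] [t Pt <-].
  exists (N (c *: x + d *: y + (c *: s + d *: t)) - N (c *: s + d *: t)).
    by exists (c *: s + d *: t) => //; exact: wP.2.
  rewrite addrACA -!scalerDr (addN _ _ (wedgeZ wP c0 Ps) (wedgeZ wP d0 Pt)).
  have := ND (c *: (x + s)) (d *: (y + t)).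
  by rewrite !NZ (ger0_norm c0) (ger0_norm d0); lra.
have ple y x : P x -> inf (A y) <= N (y + x) - N x.
  by move=> Px; apply: ge_inf; [case: (infA y)|exists x].
have N0 : N 0 = 0 by rewrite -(scale0r 0) NZ normr0 mul0r.
have [f [fp _]] := hahn_banach 0 sp.
have fN x : f x <= N x.
  apply: le_trans (fp x) _; have := ple x 0 (wedge0 wP).
  by rewrite addr0 N0 subr0.
have [e eE] : exists e : dual X, forall x, e x = f x.
  apply: (@bounded_scalar _ _ f b (linearP f)) => x.
  have := fN x; have := fN (- x); rewrite NN raddfN /= => ? ?.
  by have /andP[_] := Nab x; apply: le_trans; rewrite ler_norml; lra.
exists e, a; split=> // x Px; rewrite eE.
have := le_trans (fp (- x)) (ple (- x) x Px).
rewrite raddfN addNr N0 /= => ?; have /andP[+ _] := Nab x; lra.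
Qed.

End additive_norms.

(** * Rank one operators and their closed span *)

Section finite_rank_operators.
Context {R : realType} {X Y : normedModType R}.
Implicit Types (f : dual X) (y : Y) (S : boundedOp X Y) (A : set Y).

Lemma linear_span_sub A x : A x -> linear_span A x.
Proof.
move=> Ax; exists 1%N, (fun=> 1), (fun=> x); split=> //.
by rewrite big_ord1 scale1r.
Qed.

Lemma linear_span0 A : linear_span A 0.
Proof.
by exists 0%N, (fun=> 0), (fun=> 0); split=> [[]//|]; rewrite big_ord0.
Qed.

Lemma linear_span_linear (A B : set Y) (g : {linear Y -> Y}) :
  (forall y, A y -> linear_span B (g y)) ->
  forall y, linear_span A y -> linear_span B (g y).
Proof.
move=> AB _ [n [c [e [Ae ->]]]]; rewrite raddf_sum /=.
elim/big_rec: _ => [|i x _ Bx]; first exact: linear_span0.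
rewrite linearZ -[x]scale1r -[B]setUid.
by apply: linear_span_setU => //; exact: AB.
Qed.

Lemma rank_one_bounded f y : (fun x => (f x : R) *: y) \in bounded_linear_pred.
Proof.
apply/bounded_linearP; split.
  have fP a x z : f (a *: x + z) = a * f x + f z :> R := linearP f a x z.
  by move=> a x z; rewrite fP scalerDl scalerA.
exists (`|f| * `|y|) => x; rewrite normrZ mulrAC.
by apply: ler_wpM2r => //; exact: dual_normP.
Qed.

Definition rank_one f y : boundedOp X Y := BoundedOp (rank_one_bounded f y).

Lemma comp_bounded (g : dual Y) (T : boundedOp X Y) :
  (fun x => g (T x)) \in bounded_linear_pred.
Proof.
apply/bounded_linearP; split.
  by move=> a x z; rewrite !linearP.
exists (`|g| * `|T|) => x; apply: le_trans (dual_normP g (T x)) _.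
by rewrite -mulrA; apply: ler_wpM2l => //; exact: op_normP.
Qed.

Definition comp_dual (g : dual Y) (T : boundedOp X Y) : dual X :=
  BoundedOp (comp_bounded g T).

Lemma rank_one_finite f y : finite_rank (rank_one f y).
Proof.
exists [set y] => // _ [x _ <-] /=.
by exists 1%N, (fun=> f x), (fun=> y); split=> //; rewrite big_ord1.
Qed.

(** The functional [g] takes the value 1 at [y], except for [y = 0]; the
    conclusion holds in both cases. *)
Lemma exists_dual_normalized y : exists g : dual Y, (g y : R) *: y = y.
Proof.
have sp : sublinear (fun y : Y => `|y|).
  move=> a b v w a0 b0; apply: le_trans (ler_normD _ _) _.
  by rewrite !normrZ (ger0_norm a0) (ger0_norm b0).
have [f [fle fy]] := hahn_banach y sp.
have [g gE] : exists g : dual Y, forall v, g v = `|y|^-1 * f v.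
  apply: (@bounded_scalar _ _ (fun v => `|y|^-1 * f v) `|y|^-1) => [a v w|v].
    by rewrite linearP mulrDr mulrCA.
  rewrite normrM normfV normr_id; apply: ler_wpM2l; first by rewrite invr_ge0.
  by rewrite ler_norml; have := fle v; have := fle (- v);
    rewrite raddfN normrN /= => ? ?; lra.
exists g; have [->|y0] := eqVneq y 0; first by rewrite scaler0.
by rewrite gE fy mulVf ?scale1r// normr_eq0.
Qed.

(** If [T] has its range in the span of [y :: s], then
    [T = (g o T) ⊗ y + Q T] where [Q z = z - g(z) y] is bounded and kills
    [y], so that [Q T] has its range in the span of [map Q s]. *)
Lemma finite_rank_ind (K : set (boundedOp X Y)) : K 0 ->
  (forall f y S, K S -> K (rank_one f y + S)) -> finite_rank `<=` K.
Proof.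
move=> K0 KD T [A /finite_seqP[s ->]].
have [n] := ubnP (size s); elim: n s T => // n IHn [|y s] T /= sn Ts.
  suff -> : T = 0 by [].
  apply/val_inj/funext => x.
  have [m [c [e [Ae TxE]]]] : linear_span [set` [::]] (T x).
    by apply: Ts; exists x.
  by rewrite [LHS]TxE; apply: big1 => i _; have := Ae i; rewrite /= in_nil.
have [g gy] := exists_dual_normalized y.
rewrite -[T](subrK (rank_one (comp_dual g T) y)) addrC; apply: KD.
have linQ : linear (fun z : Y => z - (g z : R) *: y).
  have gP a v w : g (a *: v + w) = a * g v + g w :> R := linearP g a v w.
  move=> a v w; rewrite gP scalerDl opprD addrACA.
  by rewrite scalerBr scalerA.
pose fL := GRing.isLinear.Build R Y Y *:%R _ linQ.
pose Q := HB.pack_for {linear Y -> Y} (fun z : Y => z - (g z : R) *: y) fL.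
apply: (IHn (map Q s)); first by rewrite size_map.
move=> _ [x _ <-]; apply: (@linear_span_linear [set` y :: s] _ Q).
  move=> z; rewrite /= inE => /orP[/eqP ->|zs].
    by rewrite /Q /= gy subrr; exact: linear_span0.
  by apply: linear_span_sub; exact: (map_f Q zs).
by apply: Ts; exists x.
Qed.

Lemma rank_one_approximable f y : rank_one f y \in @approximable_pred R X Y.
Proof. by apply: mem_set; apply: subset_closure; exact: rank_one_finite. Qed.

Definition rank_one_approx f y : approximableOp X Y :=
  ApproximableOp (rank_one_approximable f y).

Lemma rank_one_approxPl (a : R) f g y :
  rank_one_approx (a *: f + g) y =
  a *: rank_one_approx f y + rank_one_approx g y.
Proof.
apply/val_inj/val_inj/funext => x /=.
by rewrite -[RHS]/(a *: (f x *: y) + g x *: y) scalerA -scalerDl.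
Qed.

Lemma rank_one_approxPr (a : R) f y z :
  rank_one_approx f (a *: y + z) =
  a *: rank_one_approx f y + rank_one_approx f z.
Proof.
apply/val_inj/val_inj/funext => x /=.
by rewrite -[RHS]/(a *: (f x *: y) + f x *: z) scalerDr !scalerA mulrC.
Qed.

Lemma norm_rank_one_le f y : `|rank_one f y| <= `|f| * `|y|.
Proof.
apply: op_norm_le => x x1; rewrite /= normrZ; apply: ler_wpM2r => //.
by apply: le_trans (dual_normP f x) _; exact: ler_piMr.
Qed.

(** Finite sums of rank one operators are dense in C(X, Y), and [h] is bounded
    for the operator norm. *)
Lemma approximable_ext (h : {scalar approximableOp X Y}) (M : R) :
  (forall T : approximableOp X Y, `|h T| <= M * `|T : boundedOp X Y|) ->
  (forall f y, h (rank_one_approx f y) = 0) -> forall T, h T = 0.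
Proof.
move=> hM h1.
have hfin (S : boundedOp X Y) : finite_rank S ->
    forall T : approximableOp X Y, T = S :> boundedOp X Y -> h T = 0.
  apply: (@finite_rank_ind [set S | forall T : approximableOp X Y,
    T = S :> boundedOp X Y -> h T = 0]) => [T T0|f y S' IH T TE] /=.
    by rewrite (_ : T = 0) ?raddf0//; exact: val_inj.
  rewrite -(subrK (rank_one_approx f y) T) raddfD /= h1 addr0; apply: IH.
  by rewrite -[LHS]/((T : boundedOp X Y) - rank_one f y) TE addrAC subrr add0r.
move=> T; apply/eqP; rewrite -normr_le0; apply/ler_addgt0Pr => eps eps0.
rewrite add0r.
have M1 : 0 < `|M| + 1 by rewrite ltr_wpDl.
have cT : closure finite_rank (T : boundedOp X Y) by have /set_mem := valP T.
have [S [fS]] := cT _ (nbhsx_ballx (T : boundedOp X Y) _ (divr_gt0 eps0 M1)).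
rewrite -ball_normE /= => TS.
have aS : S \in @approximable_pred R X Y.
  by apply: mem_set; exact: subset_closure.
rewrite -(subrK (ApproximableOp aS) T) raddfD /=.
rewrite (hfin S fS (ApproximableOp aS) erefl) addr0.
apply: le_trans (hM _) _; rewrite -[X in `|X|]/((T : boundedOp X Y) - S).
move: TS; rewrite ltr_pdivlMr// => TS.
have := ler_norm M; have := normr_ge0 ((T : boundedOp X Y) - S); nra.
Qed.

End finite_rank_operators.

(** * Evaluation functionals on C(X, Y) *)

Lemma boundedOp_continuous {R : realType} {X Y : normedModType R}
  (T : boundedOp X Y) : continuous (T : X -> Y).
Proof.
apply/linear_bounded_continuous/linear_boundedP; near=> r => x.
have Tr : op_norm T <= r by near: r; exact: nbhs_pinfty_ge (num_real _).
exact: le_trans (op_normP T x) (ler_wpM2r (normr_ge0 x) Tr).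
Unshelve. all: by end_near. Qed.

Section evaluation_functionals.
Context {R : realType} {X Y : normedModType R} (XP : set X) (YP : set Y).
Local Notation C := (approximableOp X Y).
Local Notation CP := (positive_approximable XP YP).
Implicit Types (T : C) (h : {scalar C}).
Hypothesis wY : wedge YP.

Definition evaluation (x : X) (y' : dual Y) (T : C) : R := y' (T x).

Lemma evaluation_scalar x y' : scalar (evaluation x y').
Proof. by move=> a S T; exact: (linearP y' a (S x) (T x)). Qed.

HB.instance Definition _ x y' :=
  GRing.isLinear.Build R C R *%R (evaluation x y') (evaluation_scalar x y').

Lemma evaluation_rank_one x y' f y :
  evaluation x y' (rank_one_approx f y) = f x * y' y.
Proof. exact: (scalarZ (scalar_of y')). Qed.

Lemma wedge_positive_approximable : wedge CP.
Proof.
split; first by exists 0 => x _; exact: wedge0.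
by move=> a b S T a0 b0 Sp Tp x Px; apply: wY.2 => //; [exact: Sp|exact: Tp].
Qed.

Lemma rank_one_positive (f : dual X) y :
  dual_wedge XP f -> YP y -> CP (rank_one_approx f y).
Proof. by move=> f0 Py x Px; apply: wedgeZ => //; exact: f0. Qed.

Section order_unit.
Variables (e : dual X) (a : R) (u : Y).
Hypotheses (a0 : 0 < a) (eP : forall x, XP x -> a * `|x| <= e x).
Hypothesis Pu : interior YP u.

Lemma strictly_positive_dual_wedge : dual_wedge XP e.
Proof. by move=> x Px; apply: le_trans (eP Px); rewrite mulr_ge0// ltW. Qed.

(** On the cone, [|T x|] is at most [|T| |x|], hence at most [|T| e(x) / a],
    and [u] absorbs vectors of Y in proportion to their norm. *)
Lemma approximable_order_unit : exists2 k : R, 0 < k &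
  forall T, CP (`|T : boundedOp X Y| *: rank_one_approx e u + k *: T).
Proof.
have [r r0 rP] := interior_order_unit wY Pu.
have Pu' : YP u by exact: nbhs_singleton.
exists (a * r); first exact: mulr_gt0.
move=> T x Px.
set n := `|T : boundedOp X Y|.
rewrite -[X in YP X]/(n *: ((e x : R) *: u) + (a * r) *: T x).
have -> : n *: ((e x : R) *: u) + (a * r) *: T x =
    (n * e x - a * `|T x|) *: u + a *: (`|T x| *: u + r *: T x).
  by rewrite scalerDr addrA !scalerA -scalerDl subrK.
apply: wedgeD => //; apply: wedgeZ => //; last exact: ltW.
rewrite subr_ge0; apply: le_trans (ler_wpM2l (ltW a0) (op_normP T x)) _.
by rewrite mulrCA; apply: ler_wpM2l (eP Px); exact: op_norm_ge0.
Qed.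

Lemma approximable_generating T : exists S, CP S /\ CP (S - T).
Proof.
have [k k0 kP] := approximable_order_unit.
have wC := wedge_positive_approximable.
exists ((`|T : boundedOp X Y| / k) *: rank_one_approx e u); split.
  apply: (wedgeZ wC); first by rewrite divr_ge0// ltW.
  by apply: rank_one_positive;
    [exact: strictly_positive_dual_wedge|exact: nbhs_singleton].
apply: (wedge_scalable wC k0).
rewrite scalerBr scalerA mulrCA divff ?gt_eqF// mulr1.
have := kP (- T).
by rewrite scalerN -[X in `|X|]/(- (T : boundedOp X Y)) normrN.
Qed.

Lemma positive_functional_bounded h : positive_functional CP h ->
  exists2 k : R, 0 < k & forall T,
    `|h T| <= k * h (rank_one_approx e u) * `|T : boundedOp X Y|.
Proof.
move=> h0; have [k k0 kP] := approximable_order_unit.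
exists k^-1; first by rewrite invr_gt0.
have le T : h T <= k^-1 * h (rank_one_approx e u) * `|T : boundedOp X Y|.
  have := h0 _ (kP (- T)); rewrite -[X in `|X|]/(- (T : boundedOp X Y)) normrN.
  rewrite raddfD /= !scalarZ raddfN /= -mulrA ler_pdivlMl//; lra.
move=> T; rewrite ler_norml le andbT.
have := le (- T); rewrite -[X in `|X|]/(- (T : boundedOp X Y)) normrN raddfN /=.
lra.
Qed.

Lemma evaluation_positive x y' : XP x -> dual_wedge YP y' ->
  positive_functional CP (evaluation x y').
Proof. by move=> Px y'0 T Tp; apply: y'0; exact: Tp. Qed.

(** [hu] uses that [x] is extremal in the bidual cone and [hpos] that [y'] is
    extremal; the constant is the same because both describe
    [h (f ⊗ u)]. *)
Lemma evaluation_extremal x y' :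
  extremal (dual_wedge (dual_wedge XP)) (bidual_embedding x) -> XP x ->
  extremal (dual_wedge YP) y' -> 0 < e x :> R -> 0 < y' u :> R ->
  extremal_functional CP (evaluation x y').
Proof.
move=> ext_x Px ext_y' ex0 yu0; have y'0 := ext_y'.1.
have fpos := evaluation_positive Px y'0.
split=> // h h0 hle; have Pu' : YP u by exact: nbhs_singleton.
have [k k0 hk] := positive_functional_bounded h0.
set M := k * h _ in hk.
have M0 : 0 <= M.
  apply: mulr_ge0; first exact: ltW.
  apply: h0; apply: rank_one_positive => //.
  exact: strictly_positive_dual_wedge.
have hr f y : `|h (rank_one_approx f y)| <= M * `|f| * `|y|.
  apply: le_trans (hk _) _; rewrite -mulrA.
  by apply: ler_wpM2l => //; exact: norm_rank_one_le.
have [c hu] : exists c, forall f : dual X,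
    h (rank_one_approx f u) = c * (y' u * f x).
  have [g gE] : exists g : dual (dual X), forall f,
      g f = h (rank_one_approx f u).
    apply: (@bounded_scalar _ _ (fun f => h (rank_one_approx f u)) (M * `|u|)).
      by move=> b f g; rewrite rank_one_approxPl linearP.
    by move=> f; rewrite mulrAC; exact: hr.
  have [_ ] := extremalZ (dual_wedge_wedge _) yu0 ext_x.
  move=> /(_ g) [|c gc].
    rewrite /cone_itv /cone_le /= subr0; split=> f f0.
      by rewrite gE; apply: h0; exact: rank_one_positive.
    rewrite -[X in 0 <= X]/(y' u * f x - g f) gE subr_ge0.
    apply: le_trans (hle _ (rank_one_positive f0 Pu')) _.
    by rewrite /= evaluation_rank_one mulrC.
  by exists c => f; rewrite -gE gc.
have hpos (f : dual X) : dual_wedge XP f -> 0 < f x :> R ->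
    forall y, h (rank_one_approx f y) = c * (f x * y' y).
  move=> f0 fx0.
  have [g gE] : exists g : dual Y, forall y, g y = h (rank_one_approx f y).
    apply: (@bounded_scalar _ _ (fun y => h (rank_one_approx f y))
      (M * `|f|)) => //.
    by move=> b y z; rewrite rank_one_approxPr linearP.
  have [_ ] := extremalZ (dual_wedge_wedge _) fx0 ext_y'.
  move=> /(_ g) [|d gd].
    rewrite /cone_itv /cone_le /= subr0; split=> y Py.
      by rewrite gE; apply: h0; exact: rank_one_positive.
    rewrite -[X in 0 <= X]/(f x * y' y - g y) gE subr_ge0.
    apply: le_trans (hle _ (rank_one_positive f0 Py)) _.
    by rewrite /= evaluation_rank_one.
  have hd y : h (rank_one_approx f y) = d * (f x * y' y) by rewrite -gE gd.
  suff <- : d = c by [].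
  have := hd u; rewrite hu [y' u * _]mulrC => /(mulIf _) -> //.
  by rewrite mulf_neq0 ?gt_eqF.
exists c => T; apply/eqP; rewrite -subr_eq0; apply/eqP.
have lin_d : scalar (fun T => h T - c * evaluation x y' T).
  by move=> b S S'; rewrite !linearP mulrBr !mulrDr opprD addrACA mulrCA.
pose fL := GRing.isLinear.Build R C R *%R _ lin_d.
have [d dE] : exists d : {scalar C}, forall T,
    d T = h T - c * evaluation x y' T.
  by exists (HB.pack_for {scalar C} (fun T => h T - c * evaluation x y' T) fL).
have [k' k'0 hk'] := positive_functional_bounded fpos.
rewrite -dE; apply: (@approximable_ext _ _ _ d
    (M + `|c| * (k' * evaluation x y' (rank_one_approx e u)))) => {T} [T|f y].
  rewrite dE; apply: le_trans (ler_normB _ _) _.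
  rewrite mulrDl; apply: lerD; first exact: hk.
  by rewrite normrM -mulrA; apply: ler_wpM2l => //; exact: hk'.
(* f is the difference of m e + f and m e, both positive and nonzero at x *)
pose m := `|f| / a + 1.
have e_le z : XP z -> e z <= (m *: e + f) z :> R.
  move=> Pz; rewrite -[X in _ <= X]/(m * e z + f z).
  have -> : m * e z + f z = e z + (`|f| / a * e z + f z) by rewrite /m; ring.
  rewrite lerDl -lerBlDr sub0r; apply: le_trans (ler_norm _) _; rewrite normrN.
  apply: le_trans (dual_normP f z) _; rewrite -mulrA; apply: ler_wpM2l => //.
  by rewrite mulrC ler_pdivlMr// mulrC; exact: eP.
have pos_me : dual_wedge XP (m *: e + f).
  move=> z Pz; apply: le_trans (e_le z Pz).
  exact: strictly_positive_dual_wedge.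
have pos_x : 0 < (m *: e + f) x :> R by exact: lt_le_trans ex0 (e_le x Px).
have d0 g : dual_wedge XP g -> 0 < g x :> R -> d (rank_one_approx g y) = 0.
  by move=> g0 gx; rewrite dE hpos// evaluation_rank_one subrr.
have -> : rank_one_approx f y =
    rank_one_approx (m *: e + f) y - m *: rank_one_approx e y.
  by rewrite rank_one_approxPl addrAC subrr add0r.
rewrite linearB scalarZ !d0 ?mulr0 ?subr0//.
exact: strictly_positive_dual_wedge.
Qed.

End order_unit.

(** The preimage of Y_+ under [T] is closed and convex, so it is enough to know
    that it contains the extremal vectors of X_+. *)
Lemma positive_approximable_extremal T :
  closed YP -> interior YP !=set0 ->
  XP `<=` closure (convex_hull (extremal XP)) ->
  (forall x y', extremal XP x -> extremal (dual_wedge YP) y' ->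
     0 <= y' (T x) :> R) -> CP T.
Proof.
move=> cY [u Pu] hullX Tpos.
have TP x : extremal XP x -> YP (T x).
  move=> ext_x; apply: contrapT => /(extremal_separation wY cY Pu)[f ext_f].
  by apply/negP; rewrite -leNgt; exact: Tpos.
have cTP : closed ((T : X -> Y) @^-1` YP).
  by apply: preimage_closed => // x _; exact: boundedOp_continuous.
suff hullT : convex_hull (extremal XP) `<=` (T : X -> Y) @^-1` YP.
  by move=> x /hullX /(closure_subset hullT) /cTP.
move=> _ [n [c [v [ext_v c0 _ ->]]]]; rewrite /preimage /= raddf_sum /=.
elim/big_rec: _ => [|i y _ Py]; first exact: wedge0.
rewrite linearZ /=; apply: wedgeD => //; apply: wedgeZ => //.
exact: TP.
Qed.

End evaluation_functionals.

Theorem corollary6p2 (R : realType) (X Y : normedModType R)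
    (XP : set X) (YP : set Y)
    (X_ons : ordered_normed_space XP) (Y_ons : ordered_normed_space YP)
    (X_neq0 : exists x : X, x != 0) (Y_neq0 : exists y : Y, y != 0)
    (XP_total : total_cone XP)
    (X_norm : exists N : X -> R, equivalent_norm N /\ additive_on XP N)
    (XP_extremal : forall x, extremal XP x ->
      extremal (dual_wedge (dual_wedge XP)) (bidual_embedding x))
    (XP_hull : XP `<=` closure (convex_hull (extremal XP)))
    (YP_interior : interior YP !=set0)
    (T1 T2 : approximableOp X Y) :
  disjoint_elts (positive_approximable XP YP) T1 T2 <->
  forall (x : X) (y' : dual Y), extremal XP x -> extremal (dual_wedge YP) y' ->
    y' (T1 x) = 0 \/ y' (T2 x) = 0.
Proof.
have [[wX _] _] := X_ons; have [[wY _] cY] := Y_ons.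
split=> [dis x y' ext_x ext_y'|disT].
  have [N [eqN addN]] := X_norm; have [u Pu] := YP_interior.
  have [e [a [a0 eP]]] := additive_norm_functional wX eqN addN.
  have Px := ext_x.1; have y'0 := ext_y'.1.
  have e0 : dual_wedge XP e := strictly_positive_dual_wedge a0 eP.
  (* e x * y' u is the value of the evaluation at the order unit e ⊗ u; if it
     vanishes, so does the evaluation *)
  have [z|] := eqVneq ((e x : R) * y' u) 0.
    have [k k0 kP] := positive_functional_bounded wY a0 eP Pu
      (evaluation_positive Px y'0).
    left; apply/eqP; rewrite -normr_le0; apply: le_trans (kP T1) _.
    by rewrite /= evaluation_rank_one z mulr0 mul0r.
  rewrite mulf_eq0 negb_or => /andP[ex yu].
  have ext := evaluation_extremal wY a0 eP Pu (XP_extremal x ext_x) Px ext_y'.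
  have [] := extremal_functional_disjoint (wedge_positive_approximable _ wY)
    (approximable_generating wY a0 eP Pu) (ext _ _) dis; last 2 first.
  - by left.
  - by right.
  - by rewrite lt_neqAle eq_sym ex; exact: e0.
  - by rewrite lt_neqAle eq_sym yu; apply: y'0; exact: nbhs_singleton.
have ub_abs A S : upper_bounds (positive_approximable XP YP) [set A; - A] S <->
    forall x y', extremal XP x -> extremal (dual_wedge YP) y' ->
      `|evaluation x y' A| <= evaluation x y' S.
  split=> [ubS x y' ext_x ext_y'|le].
    have pos B : [set A; - A] B -> 0 <= evaluation x y' (S - B).
      by move=> AB; apply: ext_y'.1; apply: ubS => //; exact: ext_x.1.
    have := pos _ (or_introl erefl); have := pos _ (or_intror erefl).
    by rewrite !raddfB raddfN /= ler_norml => ? ?; lra.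
  move=> B AB; apply: positive_approximable_extremal => // x y' ext_x ext_y'.
  have := le x y' ext_x ext_y'.
  rewrite -[X in 0 <= X]/(evaluation x y' (S - B)).
  by case: AB => ->; rewrite !raddfB ?raddfN /= ler_norml; lra.
have absE x y' : extremal XP x -> extremal (dual_wedge YP) y' ->
    `|evaluation x y' (T1 + T2)| = `|evaluation x y' (T1 - T2)|.
  move=> ext_x ext_y'; rewrite raddfB raddfD /=.
  have [z|z] := disT x y' ext_x ext_y'; rewrite /evaluation z.
    by rewrite add0r sub0r normrN.
  by rewrite addr0 subr0.
rewrite /disjoint_elts -opprD -(opprB T1 T2).
apply/seteqP; split=> S /ub_abs le; apply/ub_abs => x y' ext_x ext_y'.
  by rewrite -absE//; exact: le.
by rewrite absE//; exact: le.
Qed.
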